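(* For every $n\ge 2$, $\operatorname{rank}\mathcal{DORP}_n=3n-2$.
   Context: Let $[n]=\{1,\dots,n\}$ with its usual order. A partial transformation of $[n]$ is a function $\rho$ whose domain $\mathrm{Dom}\,\rho$ and image $\mathrm{Im}\,\rho$ are subsets of $[n]$ (the empty map is allowed). Maps are written on the right and composed left to right: $x(\rho\sigma)=(x\rho)\sigma$. $\rho$ is isotone if $x\le y$ implies $x\rho\le y\rho$ for all $x,y\in\mathrm{Dom}\,\rho$; antitone if $x\le y$ implies $x\rho\ge y\rho$; monotone if isotone or antitone; decreasing if $x\rho\le x$ for all $x\in\mathrm{Dom}\,\rho$. $\mathcal{DORP}_n$ is the monoid, under composition, of all monotone and decreasing partial transformations of $[n]$. The rank of a finitely generated semigroup $S$ is $\min\{|T|:T\subseteq S,\ \langle T\rangle=S\}$, where $\langle T\rangle$ is the subsemigroup generated by $T$ (so the identity is not obtained for free). *)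

(* Defs.v *)
From HB Require Import structures.
From mathcomp Require Import all_boot.

Set Implicit Arguments.
Unset Strict Implicit.
Unset Printing Implicit Defensive.

Local Open Scope group_scope.

#[short(type="finSemigroupType")]
HB.structure Definition FinSemigroup := {S of Semigroup S & Finite S}.

Section Rank.
Variable S : finSemigroupType.
Implicit Types T A : {set S}.

Definition mulg_closedb A := [forall x in A, forall y in A, x * y \in A].

Lemma mulg_closedP A : reflect (mulg_closed A) (mulg_closedb A).
Proof.
apply: (iffP forall_inP) => [h x y xA yA | h x xA].
  by have /forall_inP/(_ y yA) := h x xA.
by apply/forall_inP => y yA; apply: h.
Qed.

(* Subsemigroups may be empty and need not contain the identity of S, if any. *)
Definition subsemigroup_gen T : {set S} :=
  \bigcap_(A : {set S} | (T \subset A) && mulg_closedb A) A.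

Definition generates T := subsemigroup_gen T == [set: S].

Lemma generatesT : generates [set: S].
Proof.
rewrite /generates eqEsubset subsetT /=.
by apply/bigcapsP => A /andP[].
Qed.

Definition rank : nat :=
  #|[arg min_(T < [set: S] | generates T) #|T|]|.

Lemma rankP :
  (exists2 T, generates T & #|T| = rank)
  /\ (forall T, generates T -> rank <= #|T|).
Proof.
rewrite /rank; case: arg_minnP => [|T gT minT]; first exact: generatesT.
by split; [exists T | move=> A /minT].
Qed.

End Rank.

(* 'I_n = {0, ..., n-1}, ordered by value, stands for [n] = {1, ..., n}; *)
(* r x = None means that x is outside the domain of r.                    *)
Definition ptrans (n : nat) : Type := {ffun 'I_n -> option 'I_n}.

HB.instance Definition _ n := Finite.on (ptrans n).

Section PTrans.
Variable n : nat.
Implicit Types r s : ptrans n.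

Definition ptrans_one : ptrans n := [ffun x => Some x].

(* Left-to-right composition: r acts first. *)
Definition ptrans_mul r s : ptrans n := [ffun x => obind s (r x)].

Fact ptrans_mulA : associative ptrans_mul.
Proof.
move=> r s t; apply/ffunP => x; rewrite !ffunE.
by case: (r x) => [a|] //=; rewrite ffunE.
Qed.

Fact ptrans_mul1 : left_id ptrans_one ptrans_mul.
Proof. by move=> r; apply/ffunP => x; rewrite !ffunE. Qed.

Fact ptrans_mulr1 : right_id ptrans_one ptrans_mul.
Proof.
move=> r; apply/ffunP => x; rewrite !ffunE.
by case: (r x) => [a|] //=; rewrite ffunE.
Qed.

HB.instance Definition _ :=
  isMonoid.Build (ptrans n) ptrans_mulA ptrans_mul1 ptrans_mulr1.

Definition isotone r :=
  [forall x, forall y, forall a, forall b,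
     [&& r x == Some a, r y == Some b & x <= y] ==> (a <= b)].

Definition antitone r :=
  [forall x, forall y, forall a, forall b,
     [&& r x == Some a, r y == Some b & x <= y] ==> (b <= a)].

Definition monotone r := isotone r || antitone r.

Definition decreasing r := [forall x, forall a, (r x == Some a) ==> (a <= x)].

Definition is_dorp : pred (ptrans n) := fun r => monotone r && decreasing r.

Lemma isotoneP r :
  reflect (forall x y a b, r x = Some a -> r y = Some b -> x <= y -> a <= b)
          (isotone r).
Proof.
apply: (iffP idP) => [h x y a b rx ry xy | h].
  move/forallP/(_ x)/forallP/(_ y)/forallP/(_ a)/forallP/(_ b)/implyP: h.
  by apply; rewrite rx ry !eqxx.
do 4!apply/forallP=> ?; apply/implyP => /and3P[/eqP rx /eqP ry].
exact: h rx ry.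
Qed.

Lemma antitoneP r :
  reflect (forall x y a b, r x = Some a -> r y = Some b -> x <= y -> b <= a)
          (antitone r).
Proof.
apply: (iffP idP) => [h x y a b rx ry xy | h].
  move/forallP/(_ x)/forallP/(_ y)/forallP/(_ a)/forallP/(_ b)/implyP: h.
  by apply; rewrite rx ry !eqxx.
do 4!apply/forallP=> ?; apply/implyP => /and3P[/eqP rx /eqP ry].
exact: h rx ry.
Qed.

Lemma decreasingP r :
  reflect (forall x a, r x = Some a -> a <= x) (decreasing r).
Proof.
apply: (iffP idP) => [h x a rx | h].
  by move/forallP/(_ x)/forallP/(_ a)/implyP: h; apply; rewrite rx.
by do 2!apply/forallP=> ?; apply/implyP => /eqP; apply: h.
Qed.

Lemma ptrans_mulP r s x c :
  (r * s) x = Some c <-> exists2 a, r x = Some a & s a = Some c.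
Proof.
have -> : (r * s) x = obind s (r x) by rewrite ffunE.
case: (r x) => [a|] /=; last by split => // -[].
by split => [sa | [? [<-]] //]; exists a.
Qed.

Lemma ptrans_oneE x : (1 : ptrans n) x = Some x.
Proof. by rewrite ffunE. Qed.

Lemma is_dorp_monoid_closed : monoid_closed is_dorp.
Proof.
split=> [|r s].
  apply/andP; split; last by apply/decreasingP => x a; rewrite ptrans_oneE => -[->].
  apply/orP; left; apply/isotoneP => x y a b.
  by rewrite !ptrans_oneE => -[->] [->].
move=> /andP[mr /decreasingP dr] /andP[ms /decreasingP ds].
apply/andP; split; last first.
  apply/decreasingP => x c /ptrans_mulP[a rx sa].
  exact: leq_trans (ds _ _ sa) (dr _ _ rx).
rewrite /monotone; case/orP: mr => [/isotoneP|/antitoneP] mr;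
  case/orP: ms => [/isotoneP|/antitoneP] ms; apply/orP.
- left; apply/isotoneP => x y c d /ptrans_mulP[a rx sa] /ptrans_mulP[b ry sb].
  by move=> /(mr _ _ _ _ rx ry) /(ms _ _ _ _ sa sb).
- right; apply/antitoneP => x y c d /ptrans_mulP[a rx sa] /ptrans_mulP[b ry sb].
  by move=> /(mr _ _ _ _ rx ry) /(ms _ _ _ _ sa sb).
- right; apply/antitoneP => x y c d /ptrans_mulP[a rx sa] /ptrans_mulP[b ry sb].
  by move=> /(mr _ _ _ _ rx ry) /(ms _ _ _ _ sb sa).
- left; apply/isotoneP => x y c d /ptrans_mulP[a rx sa] /ptrans_mulP[b ry sb].
  by move=> /(mr _ _ _ _ rx ry) /(ms _ _ _ _ sb sa).
Qed.

Record DORP := MkDORP { dorp_val :> ptrans n; _ : is_dorp dorp_val }.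

HB.instance Definition _ := [isSub for dorp_val].
HB.instance Definition _ := [Finite of DORP by <:].
HB.instance Definition _ :=
  SubChoice_isSubMonoid.Build (ptrans n) is_dorp DORP is_dorp_monoid_closed.

End PTrans.

(* Main.v *)
(* Generators: the identity, the n partial identities omitting one point, the  *)
(* n - 1 maps moving one point x to x - 1, and the n - 2 partial reflections in *)
(* an interior point k.  An isotone decreasing map is a product of the first    *)
(* three kinds: peel one factor off at its largest non-fixed point.  An         *)
(* antitone map whose domain has least point k is isotone * reflection in k *   *)
(* isotone.  Conversely the identity, the omissions and the one-point moves are *)
(* irreducible, and if f g fixes k and sends k + 1 to k - 1 then so does f or g; *)
(* this gives 3n - 2 disjoint nonempty sets with multiplicatively closed        *)
(* complements, each of which must meet every generating set.                   *)

Require Import Defs.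
From mathcomp Require Import all_boot.
From mathcomp Require Import zify.

Set Implicit Arguments.
Unset Strict Implicit.
Unset Printing Implicit Defensive.

Local Open Scope group_scope.

(** If a product of decreasing maps fixes x, both factors fix x ([mul_fix]). So when a product has
    at most one non-fixed point, both factors fix all the others, and comparing values at the
    exceptional point shows that one factor is the product itself. This places the identity, the
    omissions and the one-point moves in every generating set. For a reflection only its values at
    two neighbouring points are traced ([turns]): this trace passes from a product to a factor, and
    no map in the monoid carries two of them. [leq_card_rank] turns this into the lower bound. The
    matching upper bound is [dorp_generated], which rests on [isotone_generated] and
    [antitone_factor]. *)

(** * Generating sets and bounds on the rank *)

Section Generation.
Variable S : finSemigroupType.
Implicit Types A P T : {set S}.

Lemma generatesP T :
  reflect (forall A, T \subset A -> mulg_closed A -> A = [set: S])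
          (generates T).
Proof.
apply: (iffP eqP) => [genT A sTA /mulg_closedP Acl | genT].
  apply/eqP; rewrite eqEsubset subsetT -genT.
  by apply: bigcap_inf; rewrite sTA.
apply/eqP; rewrite eqEsubset subsetT; apply/bigcapsP => A /andP[sTA].
by move=> /mulg_closedP Acl; rewrite (genT A).
Qed.

(** A generating set that missed P would lie in the subsemigroup complementary to P, which is
    proper. *)
Lemma generates_meets T P :
  generates T -> mulg_closed (~: P) -> P != set0 -> exists2 t, t \in T & t \in P.
Proof.
move=> /generatesP genT Pcl /set0Pn[p pP]; apply/exists_inP.
apply/contraT => /exists_inPn nTP.
suff: p \in ~: P by rewrite inE pP.
rewrite (genT _ _ Pcl) ?inE //.
by apply/subsetP => t /nTP; rewrite inE.
Qed.

Lemma leq_card_rank (I : finType) (P : I -> {set S}) :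
  (forall i, P i != set0) -> (forall i, mulg_closed (~: P i)) ->
  (forall i j x, x \in P i -> x \in P j -> i = j) -> #|I| <= rank S.
Proof.
move=> P0 Pcl Pinj; have [[T genT <-] _] := rankP S.
have /fin_all_exists2[t tT tP] i : exists2 t, t \in T & t \in P i.
  exact: generates_meets.
have t_inj : injective t by move=> i j tij; apply: (Pinj _ _ (t i)); rewrite // tij.
by rewrite -(card_codom t_inj); apply/subset_leq_card/subsetP => _ /codomP[i ->].
Qed.

Lemma rank_leq_card (I : finType) (f : I -> S) :
  generates [set f i | i : I] -> rank S <= #|I|.
Proof.
by move=> gen; apply: leq_trans ((rankP S).2 _ gen) _; apply: leq_imset_card.
Qed.

End Generation.

(** * The generators *)

Section Generators.
Variable n : nat.
Implicit Types (f g : ptrans n.+1) (x y a b : 'I_n.+1) (k : nat).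

Definition omit x : ptrans n.+1 := [ffun y => if y == x then None else Some y].

Definition collapse k : ptrans n.+1 :=
  [ffun y : 'I_n.+1 => Some (if y == k.+1 :> nat then inord k else y)].

(* Truncated subtraction sends every point beyond 2k to the least element. *)
Definition reflection k : ptrans n.+1 :=
  [ffun y : 'I_n.+1 => if k <= y then Some (inord (k.*2 - y)) else None].

Lemma mul_ptransE f g x : (f * g) x = obind g (f x).
Proof. by rewrite ffunE. Qed.

Lemma isotone_one : isotone (1 : ptrans n.+1).
Proof. by apply/isotoneP => x y a b; rewrite !ptrans_oneE => -[<-] [<-]. Qed.

Lemma isotone_omit x : isotone (omit x).
Proof.
by apply/isotoneP => y z a b; rewrite !ffunE; do 2!case: eqP => // _; move=> [<-] [<-].
Qed.

Lemma isotone_collapse k : isotone (collapse k).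
Proof.
apply/isotoneP => x y a b; rewrite !ffunE => -[<-] [<-] xy.
have := ltn_ord x; have := ltn_ord y => yn xn.
by case: eqP => xk; case: eqP => yk; rewrite ?inordK; lia.
Qed.

Lemma antitone_reflection k : antitone (reflection k).
Proof.
apply/antitoneP => x y a b; rewrite !ffunE.
have := ltn_ord x; have := ltn_ord y => yn xn.
case: leqP => // kx [<-]; case: leqP => // ky [<-] xy.
by rewrite !inordK; lia.
Qed.

Lemma decreasing_omit x : decreasing (omit x).
Proof. by apply/decreasingP => y a; rewrite ffunE; case: eqP => // _ [<-]. Qed.

Lemma decreasing_collapse k : decreasing (collapse k).
Proof.
apply/decreasingP => x a; rewrite ffunE => -[<-]; have := ltn_ord x => xn.
by case: eqP => // xk; rewrite inordK; lia.
Qed.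

Lemma decreasing_reflection k : decreasing (reflection k).
Proof.
apply/decreasingP => x a; rewrite ffunE; have := ltn_ord x => xn.
by case: leqP => // kx [<-]; rewrite inordK; lia.
Qed.

(** * Generation of the isotone maps *)

(** Total distance below the identity. An undefined point counts as having value -1, so that
    defining it is also a raise. *)
Definition defect f := \sum_x (if f x is Some a then x - a else x.+1).

Definition update f x a : ptrans n.+1 := [ffun y => if y == x then Some a else f y].

Lemma ltn_defect_update f x a :
  a <= x -> (forall b, f x = Some b -> b < a) -> defect (update f x a) < defect f.
Proof.
move=> ax fxa; rewrite /defect (bigD1 x) // [ltnRHS](bigD1 x) //= ffunE eqxx.
rewrite -addSn leq_add //.
  by case: (f x) fxa => [b /(_ _ erefl)|_] /=; lia.
by apply: leq_sum => y /negPf yx; rewrite ffunE yx.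
Qed.

Lemma decreasing_update f x a : a <= x -> decreasing f -> decreasing (update f x a).
Proof.
move=> ax /decreasingP fd; apply/decreasingP => y b; rewrite ffunE.
by case: eqP => [-> [<-] //|_]; apply: fd.
Qed.

Lemma isotone_update f x a :
  isotone f -> a <= x ->
  (forall y b, y < x -> f y = Some b -> b <= a) ->
  (forall y, x < y -> f y = Some y) -> isotone (update f x a).
Proof.
move=> /isotoneP fi ax below above; apply/isotoneP => y z b c; rewrite !ffunE.
case: (eqVneq y x) => [-> [<-]|yx].
  case: (eqVneq z x) => [_ [<-] //|zx fz xz].
  have xz' : x < z by rewrite ltn_neqAle eq_sym zx.
  by move: fz; rewrite above // => -[<-]; lia.
case: (eqVneq z x) => [-> fy [<-] yx'|_]; last exact: fi.
by apply: below fy; rewrite ltn_neqAle yx.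
Qed.

Lemma isotone_generated (Q : ptrans n.+1 -> Prop) :
  Q 1 -> (forall x, Q (omit x)) -> (forall k, k < n -> Q (collapse k)) ->
  (forall f g, Q f -> Q g -> Q (f * g)) ->
  forall f, isotone f -> decreasing f -> Q f.
Proof.
move=> Q1 Qd Qc QM f; have [m] := ubnP (defect f).
elim: m f => // m IHm f fm fi fd.
have [x0 nfx0|f1] := pickP (fun x => f x != Some x); last first.
  suff -> : f = 1 by [].
  by apply/ffunP => x; rewrite ptrans_oneE; apply/eqP/negbFE/f1.
have [x nfx xmax] := @arg_maxnP _ x0 (fun x => f x != Some x) val nfx0.
have above y : x < y -> f y = Some y.
  by move=> xy; apply/eqP/contraT => /xmax /=; lia.
have Qup a : a <= x -> (forall b, f x = Some b -> b < a) ->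
    (forall y b, y < x -> f y = Some b -> b <= a) -> Q (update f x a).
  move=> ax fxa below; apply: IHm; first exact: leq_trans (ltn_defect_update ax fxa) fm.
    exact: isotone_update.
  exact: decreasing_update.
case fx: (f x) => [v|].
- have vx : v < x.
    move/decreasingP/(_ _ _ fx): (fd); rewrite leq_eqVlt => /orP[/eqP/val_inj vx|//].
    by rewrite fx vx eqxx in nfx.
  have vn : v < n by have := ltn_ord x; lia.
  (* Points below x have values at most v and points above x are fixed, so after the raise v + 1 is
     taken only at x, and [collapse v] changes nothing else. *)
  have -> : f = update f x (inord v.+1) * collapse v.
    apply/ffunP => y; rewrite mul_ptransE [update _ _ _ _]ffunE.
    case: eqP => [->|/eqP yx] /=.
      by rewrite fx ffunE inordK // eqxx inord_val.
    case fy: (f y) => [b|] //=; rewrite ffunE; case: eqP => // bv.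
    have [yx'|xy] := ltnP y x.
      by move/isotoneP/(_ _ _ _ _ fy fx): fi => /(_ (ltnW yx')); lia.
    have xy' : x < y by rewrite ltn_neqAle eq_sym yx.
    by move: fy; rewrite above // => -[yb]; move: xy'; rewrite yb; lia.
  apply: QM; last exact: Qc.
  apply: Qup; rewrite ?inordK //; first by move=> b; rewrite fx => -[<-].
  move=> y b yx fy; apply/leqW.
  by move/isotoneP: fi => /(_ _ _ _ _ fy fx); apply; apply: ltnW.
- have -> : f = omit x * update f x x.
    apply/ffunP => y; rewrite mul_ptransE [omit _ _]ffunE.
    by case: eqP => [->|/eqP yx] //=; rewrite ffunE (negPf yx).
  apply: QM; first exact: Qd.
  apply: Qup => // [b|y b yx fy]; first by rewrite fx.
  by apply: leq_trans (ltnW yx); move/decreasingP: fd; apply.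
Qed.


(** * Factorization of the antitone maps *)

Lemma leq_card_ord_interval (A : {set 'I_n.+1}) l u :
  (forall x, x \in A -> l <= x < u) -> #|A| <= u - l.
Proof.
move=> Alu; rewrite cardE -(size_map val) -(size_iota l (u - l)).
apply: uniq_leq_size; first by rewrite map_inj_uniq ?enum_uniq //; apply: val_inj.
by move=> _ /mapP[x + ->]; rewrite mem_enum mem_iota => /Alu /=; lia.
Qed.

Section Antitone.
Variables (f : ptrans n.+1) (k : nat).
Hypothesis fa : antitone f.
Hypothesis f_ge : forall x a, f x = Some a -> k <= x.
Hypothesis f_le : forall x a, f x = Some a -> a <= k.

Let im := [set a | [exists x, f x == Some a]].
Let height a := #|[set b in im | a < b]|.

Let imP a : reflect (exists x, f x = Some a) (a \in im).
Proof. by rewrite inE; apply: (iffP existsP) => -[x /eqP]; exists x => //; apply/eqP. Qed.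

Let height_le a b : a <= b -> height b <= height a.
Proof.
move=> ab; apply/subset_leq_card/subsetP => c.
by rewrite !in_set => /andP[-> /(leq_ltn_trans ab)].
Qed.

Let height_lt a b : b \in im -> a < b -> height b < height a.
Proof.
move=> bim ab; apply/proper_card/properP; split.
  by apply/subsetP => c; rewrite !in_set => /andP[-> /(ltn_trans ab)].
by exists b; rewrite in_set bim ?ltnn.
Qed.

(** The image points above a lie between a + 1 and k. *)
Let height_im a : a \in im -> a + height a <= k.
Proof.
move=> /imP[x fx]; have ak := f_le fx.
suff : height a <= k.+1 - a.+1 by lia.
apply: leq_card_ord_interval => b; rewrite in_set => /andP[/imP[y fy] ->].
exact: f_le fy.
Qed.

(** By antitonicity, every image point above a has its preimages in the interval from k to x - 1;
    distinct image points have distinct preimages. *)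
Let height_preim x a : f x = Some a -> k + height a <= x.
Proof.
move=> fx; have kx := f_ge fx.
suff : height a <= x - k by lia.
pose J := [set y : 'I_n.+1 | k <= y < x].
apply: leq_trans (_ : #|J| <= _); last first.
  by apply: leq_card_ord_interval => y; rewrite in_set.
apply: leq_trans (leq_imset_card (fun y => odflt ord0 (f y)) J).
apply/subset_leq_card/subsetP => b; rewrite in_set => /andP[/imP[y fy] ab].
apply/imsetP; exists y; last by rewrite fy.
rewrite in_set (f_ge fy) ltnNge; apply/negP => xy.
by have := antitoneP _ fa _ _ _ _ fx fy xy; lia.
Qed.

Let squeeze : ptrans n.+1 := [ffun x => omap (fun a => inord (k + height a)) (f x)].

(** The choice is forced: [height] is strictly decreasing on the image, so at most one image point
    has height k - c. *)
Let spread : ptrans n.+1 :=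
  [ffun c : 'I_n.+1 => [pick a in im | c + height a == k]].

Let squeezeP x b :
  squeeze x = Some b -> exists2 a, f x = Some a & b = k + height a :> nat.
Proof.
rewrite ffunE; case fx: (f x) => [a|] //= [<-]; exists a => //.
by rewrite inordK //; apply: leq_ltn_trans (ltn_ord x); apply: height_preim.
Qed.

Let spreadP c a : spread c = Some a -> a \in im /\ c + height a = k.
Proof. by rewrite ffunE; case: pickP => // b /andP[bim /eqP bc] [<-]. Qed.

(* With height a the number of image points above a, f factors at each value a *)
(* as x |-> k + height a |-> k - height a |-> a.                               *)
Lemma antitone_factor :
  exists g h, [/\ f = g * reflection k * h, isotone g /\ decreasing g
                & isotone h /\ decreasing h].
Proof.
exists squeeze, spread; split; [|split|split].
- apply/ffunP => x; rewrite !mul_ptransE.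
  case sx: (squeeze x) => [b|]; last by move: sx; rewrite ffunE; case: (f x).
  have [a fx ba] := squeezeP sx; have := ltn_ord b => bn /=.
  have aim : a \in im by apply/imP; exists x.
  have := height_im aim => ak.
  rewrite fx ffunE ba leq_addr /= ffunE inordK; last by lia.
  case: pickP => [c /andP[cim /eqP cH]|/(_ a)]; last by rewrite aim; lia.
  congr Some; apply/val_inj => /=; case: (ltngtP a c) => //.
    by move/(height_lt cim); lia.
  by move/(height_lt aim); lia.
- apply/isotoneP => x y a b /squeezeP[a' fx ->] /squeezeP[b' fy ->] xy.
  by rewrite leq_add2l; apply/height_le/(antitoneP _ fa _ _ _ _ fx fy).
- by apply/decreasingP => x a /squeezeP[a' fx ->]; apply: height_preim.
- apply/isotoneP => x y a b /spreadP[aim xa] /spreadP[bim yb] xy.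
  by rewrite leqNgt; apply/negP => /(height_lt aim); lia.
- by apply/decreasingP => x a /spreadP[/height_im]; lia.
Qed.

End Antitone.

Lemma dorp_generated (Q : ptrans n.+1 -> Prop) :
  Q 1 -> (forall x, Q (omit x)) -> (forall k, k < n -> Q (collapse k)) ->
  (forall k, 0 < k < n -> Q (reflection k)) ->
  (forall f g, Q f -> Q g -> Q (f * g)) ->
  forall f, is_dorp f -> Q f.
Proof.
move=> Q1 Qo Qc Qr QM f /andP[mf fd].
have Qi g : isotone g /\ decreasing g -> Q g by case; apply: isotone_generated.
have [fi|nfi] := boolP (isotone f); first exact: Qi.
have fa : antitone f by move: mf; rewrite /monotone (negPf nfi).
move: nfi; rewrite /isotone.
move=> /forallPn[x /forallPn[y /forallPn[a /forallPn[b]]]].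
rewrite negb_imply -ltnNge => /andP[/and3P[/eqP fx /eqP fy xy] ba].
have dx : (fun x => isSome (f x)) x by rewrite fx.
have [z + zmin] := @arg_minnP _ x (fun x => isSome (f x)) val dx.
case fz: (f z) => [c|] // _.
have f_ge w d : f w = Some d -> z <= w by move=> fw; apply: zmin; rewrite fw.
have cz := decreasingP _ fd _ _ fz.
have f_le w d : f w = Some d -> d <= z.
  move=> fw; apply: leq_trans cz.
  exact: antitoneP _ fa _ _ _ _ fz fw (f_ge _ _ fw).
have [g [h [-> /Qi Qg /Qi Qh]]] := antitone_factor fa f_ge f_le.
have xy' : x < y.
  rewrite ltn_neqAle xy andbT; apply/eqP => /val_inj exy.
  by move: fx ba; rewrite exy fy => -[->]; rewrite ltnn.
apply: (QM) => //; apply: QM => //; apply: Qr.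
(* The centre z is interior: b < a <= z gives 0 < z, and z <= x < y gives z < n. *)
by have := f_ge _ _ fx; have := f_le _ _ fx; have := ltn_ord y; lia.
Qed.

(** * Irreducibility *)

Section Irreducible.
Variables f g : ptrans n.+1.
Hypotheses (fd : decreasing f) (gd : decreasing g).

(** Squeeze: the image a of x under f satisfies x = a g <= a <= x. *)
Lemma mul_fix x : (f * g) x = Some x -> f x = Some x /\ g x = Some x.
Proof.
move=> /ptrans_mulP[a fx ga].
suff ax : a = x by rewrite ax in fx ga.
by apply/val_inj/anti_leq; rewrite (decreasingP _ fd _ _ fx) (decreasingP _ gd _ _ ga).
Qed.

Lemma one_irreducible : f * g = 1 -> f = 1.
Proof.
move=> fg1; apply/ffunP => x; rewrite ptrans_oneE.
by apply: (mul_fix _).1; rewrite fg1 ptrans_oneE.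
Qed.

Lemma omit_irreducible x : f * g = omit x -> f = omit x \/ g = omit x.
Proof.
move=> fg; have fixed y : y != x -> f y = Some y /\ g y = Some y.
  by move=> /negPf yx; apply: mul_fix; rewrite fg ffunE yx.
have eq_omit (h : ptrans n.+1) :
    h x = None -> (forall y, y != x -> h y = Some y) -> h = omit x.
  move=> hx hy; apply/ffunP => y; rewrite ffunE.
  by case: (eqVneq y x) => [->|/hy].
have fgx : (f * g) x = None by rewrite fg ffunE eqxx.
rewrite mul_ptransE in fgx; case fx: (f x) fgx => [a|] /= ga; last first.
  by left; apply: eq_omit => // y /fixed[].
(* Here g is undefined at a, whereas it fixes every point other than x; so a = x and g is the
   omission. *)
case: (eqVneq a x) => [ax|/fixed[_]]; last by rewrite ga.
by right; apply: eq_omit => [|y /fixed[]] //; rewrite -ax.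
Qed.

Lemma collapse_irreducible k :
  k < n -> f * g = collapse k -> f = collapse k \/ g = collapse k.
Proof.
move=> kn fg; pose x : 'I_n.+1 := inord k.+1; pose z : 'I_n.+1 := inord k.
have xk : x = k.+1 :> nat by rewrite inordK.
have zk : z = k :> nat by rewrite inordK //; apply: leqW.
have collapseE y : collapse k y = Some (if y == x then z else y).
  by rewrite ffunE -val_eqE /= xk.
have fixed y : y != x -> f y = Some y /\ g y = Some y.
  by move=> /negPf yx; apply: mul_fix; rewrite fg collapseE yx.
have eq_collapse (h : ptrans n.+1) :
    h x = Some z -> (forall y, y != x -> h y = Some y) -> h = collapse k.
  move=> hx hy; apply/ffunP => y; rewrite collapseE.
  by case: (eqVneq y x) => [->|/hy].
have : (f * g) x = Some z by rewrite fg collapseE eqxx.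
(* If f fixes x, then g makes the move; otherwise g fixes a, so f has already sent x to z. *)
move=> /ptrans_mulP[a fx ga]; case: (eqVneq a x) => [ax|/fixed[_]].
  by right; apply: eq_collapse => [|y /fixed[]] //; rewrite -ax.
rewrite ga => -[za]; left; apply: eq_collapse => [|y /fixed[]] //.
by rewrite fx za.
Qed.

(** The trace of the reflection centred at k + 1; the shift lets k start at 0. *)
Definition turns k (h : ptrans n.+1) :=
  (h (inord k.+1) == Some (inord k.+1)) && (h (inord k.+2) == Some (inord k)).

(** Both factors fix k + 1, and f sends k + 2 to some a between k and k + 2. The value a = k + 1 is
    impossible, since g would fix it; a = k makes f turn, and a = k + 2 makes g turn. *)
Lemma turns_irreducible k : k.+1 < n -> turns k (f * g) -> turns k f || turns k g.
Proof.
move=> kn /andP[/eqP/mul_fix[fx gx] /eqP/ptrans_mulP[a fy ga]].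
rewrite /turns fx fy gx eqxx /=.
have := decreasingP _ fd _ _ fy; have := decreasingP _ gd _ _ ga.
rewrite !inordK; try by lia.
move=> ka ak; case: (ltngtP a k.+1) => ak1.
- apply/orP; left; rewrite (_ : a = inord k) //.
  by apply/val_inj => /=; rewrite inordK; lia.
- apply/orP; right; rewrite -ga (_ : inord k.+2 = a) //.
  by apply/val_inj => /=; rewrite inordK; lia.
- have ax : a = inord k.+1 by apply/val_inj => /=; rewrite inordK; lia.
  by move: ga; rewrite ax gx => -[/(congr1 val)] /=; rewrite !inordK; lia.
Qed.

End Irreducible.

Lemma turns_reflection k : k.+1 < n -> turns k (reflection k.+1).
Proof.
move=> kn; have [k1 k2] : k.+1.*2 - k.+1 = k.+1 /\ k.+1.*2 - k.+2 = k by lia.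
by rewrite /turns !ffunE !inordK ?leqnSn ?leqnn ?k1 ?k2 ?eqxx //; lia.
Qed.

Lemma turns_not_isotone k f : k.+1 < n -> turns k f -> ~~ isotone f.
Proof.
move=> kn /andP[/eqP fx /eqP fy]; apply/negP => /isotoneP/(_ _ _ _ _ fx fy).
by rewrite !inordK; lia.
Qed.

(** A turning map is antitone. For k < l it would send k + 2 <= l + 1 to k and l + 1 to l + 1 > k,
    reversing nothing. *)
Lemma turns_inj k l f :
  monotone f -> k.+1 < n -> l.+1 < n -> turns k f -> turns l f -> k = l.
Proof.
move=> mf; wlog kl : k l / k < l.
  by move=> IH kn ln fk fl; case: (ltngtP k l) => // ?; [|symmetry]; apply: IH.
move=> kn ln fk; have := turns_not_isotone kn fk.
move: mf => /orP[->//|/antitoneP fa] _ /andP[/eqP fx _].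
case/andP: fk => _ /eqP fy; have := fa _ _ _ _ fy fx.
by rewrite !inordK; lia.
Qed.

(** * Counting the generators *)

Section Rank.
Hypothesis n_gt0 : 0 < n.

(* One index for each of the 3 n + 1 = 3 (n + 1) - 2 generators. *)
Let I := (option ('I_n.+1 + 'I_n) + 'I_n.-1)%type.

Let isotone_gen (i : option ('I_n.+1 + 'I_n)) : ptrans n.+1 :=
  match i with
  | None => 1
  | Some (inl x) => omit x
  | Some (inr k) => collapse k
  end.

Let gen (i : I) : ptrans n.+1 :=
  match i with inl j => isotone_gen j | inr k => reflection k.+1 end.

Let isotone_genP i : isotone (isotone_gen i) /\ decreasing (isotone_gen i).
Proof.
case: i => [[x|k]|] /=; split;
  rewrite ?isotone_omit ?isotone_collapse ?isotone_one //;
  rewrite ?decreasing_omit ?decreasing_collapse //.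
by apply/decreasingP => x a; rewrite ptrans_oneE => -[<-].
Qed.

(** Apart from the identity, each of these maps has exactly one non-fixed point; that point, and
    whether the map is defined there, determine the map. *)
Let isotone_gen_inj : injective isotone_gen.
Proof.
move=> [[x|k]|] [[y|l]|] //= /ffunP eqg.
- by move: (eqg x); rewrite !ffunE eqxx; case: eqP => [->|].
- by move: (eqg x); rewrite !ffunE eqxx.
- by move: (eqg x); rewrite !ffunE eqxx.
- by move: (eqg y); rewrite !ffunE eqxx.
- move: (eqg (inord k.+1)); have := ltn_ord k; have := ltn_ord l => ln kn.
  rewrite !ffunE inordK // eqxx; case: eqP => [[/val_inj->] //|_] [/(congr1 val)] /=.
  by rewrite !inordK; lia.
- move: (eqg (inord k.+1)); have := ltn_ord k => kn.
  rewrite !ffunE inordK // eqxx => -[/(congr1 val)] /=.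
  by rewrite !inordK; lia.
- by move: (eqg y); rewrite !ffunE eqxx.
- move: (eqg (inord l.+1)); have := ltn_ord l => ln.
  rewrite !ffunE inordK // eqxx => -[/(congr1 val)] /=.
  by rewrite !inordK; lia.
Qed.

Let gen_dorp i : is_dorp (gen i).
Proof.
rewrite /is_dorp /monotone; case: i => [j|k] /=.
  by have [-> ->] := isotone_genP j.
by rewrite antitone_reflection decreasing_reflection orbT.
Qed.

Let dorp_gen i : DORP n.+1 := MkDORP (gen_dorp i).

Let turn_lt (k : 'I_n.-1) : k.+1 < n.
Proof. by have := ltn_ord k; lia. Qed.

Lemma rank_DORP : rank (DORP n.+1) = (3 * n).+1.
Proof.
have -> : (3 * n).+1 = #|{: I}| by rewrite card_sum card_option card_sum !card_ord; lia.
apply/anti_leq/andP; split.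
  apply: (rank_leq_card (f := dorp_gen)); apply/generatesP => A sTA Acl.
  have genA i : exists2 u : DORP n.+1, u \in A & dorp_val u = gen i.
    by exists (dorp_gen i) => //; apply/(subsetP sTA)/imset_f.
  apply/setP => u; rewrite inE.
  suff [v vA vu] : exists2 v : DORP n.+1, v \in A & dorp_val v = dorp_val u.
    by rewrite -(val_inj vu : v = u).
  (* Membership in A is read on the underlying partial maps, where [dorp_generated] applies. *)
  apply: (dorp_generated (Q := fun f => exists2 v : DORP n.+1, v \in A & dorp_val v = f)).
  - exact: genA (inl None).
  - by move=> x; apply: genA (inl (Some (inl x))).
  - by move=> k kn; apply: genA (inl (Some (inr (Ordinal kn)))).
  - move=> [//|k] kn; have kn' : k < n.-1 by lia.
    exact: genA (inr (Ordinal kn')).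
  - move=> _ _ [v vA <-] [w wA <-]; exists (v * w) => //.
    exact: Acl.
  - exact: valP u.
(* Singletons for the isotone generators, whole classes of turning maps for the reflections. *)
pose P (i : I) : {set DORP n.+1} :=
  match i with
  | inl j => [set u | dorp_val u == isotone_gen j]
  | inr k => [set u | turns k (dorp_val u)]
  end.
apply: (leq_card_rank (P := P)) => [i|i u v|i j u].
- apply/set0Pn; exists (dorp_gen i); case: i => [j|k]; rewrite inE //=.
  exact: turns_reflection.
- have /andP[_ ud] := valP u; have /andP[_ vd] := valP v.
  rewrite !in_setC => uP vP; apply/negP => uvP; move: uP vP.
  case: i uvP => [j|k] /=; rewrite !inE /=; last first.
    by move=> /turns_irreducible-/(_ ud vd (turn_lt k)) /orP[->|->].
  move=> /eqP uv; suff [->|->] : dorp_val u = isotone_gen j \/ dorp_val v = isotone_gen j.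
  + by rewrite eqxx.
  + by rewrite eqxx.
  case: j uv => [[x|k]|] /=.
  + exact: omit_irreducible.
  + exact: collapse_irreducible.
  + by move/one_irreducible; left; auto.
- have /andP[um _] := valP u.
  case: i j => [i|k] [j|l]; rewrite !inE.
  + by move=> /eqP-> /eqP/isotone_gen_inj->.
  + by move=> /eqP-> /(turns_not_isotone (turn_lt l)); rewrite (isotone_genP i).1.
  + move=> /(turns_not_isotone (turn_lt k)) nui /eqP uj.
    by rewrite uj (isotone_genP j).1 in nui.
  + by move=> uk ul; congr inr; apply/val_inj; apply: turns_inj um _ _ uk ul.
Qed.

End Rank.
End Generators.

Theorem theorem3p20 (n : nat) (hn : 2 <= n) : rank (DORP n) = 3 * n - 2.
Proof.
case: n hn => [|n] // hn; rewrite rank_DORP //; lia.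
Qed.
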